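(* Let $\alpha$ be any nonzero real number and let $n$ be any positive integer. Then $$\sum_{k=1}^{n}\Big(1-\frac{1}{\alpha}\Big)_k B_{n,k}\big((\alpha)_1,(\alpha)_2,\ldots,(\alpha)_{n-k+1}\big)=(\alpha-1)_n.$$
   Context: $(x)_k=x(x-1)(x-2)\cdots(x-k+1)$ denotes the falling factorial. For integers $1\le k\le n$, the partial exponential Bell polynomial is $$B_{n,k}(x_1,\ldots,x_{n-k+1})=n!\sum_{\Lambda^k_n}\prod_{j=1}^{n-k+1}\frac{1}{k_j!}\Big(\frac{x_j}{j!}\Big)^{k_j},$$ where the sum is over $\Lambda^k_n=\{(k_1,\ldots,k_{n-k+1}): \sum_j k_j=k,\ \sum_j jk_j=n,\ k_j\in\mathbb{Z}_{\ge 0}\}$. *)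

(* Defs.v *)
From HB Require Import structures.
From mathcomp Require Import all_boot all_order all_algebra.
From mathcomp Require Import reals.
Set Implicit Arguments.
Unset Strict Implicit.
Unset Printing Implicit Defensive.
Import GRing.Theory.
Local Open Scope ring_scope.

Definition ffactr (R : pzRingType) (x : R) (k : nat) : R :=
  \prod_(i < k) (x - i%:R).

(* The index set Lambda^k_n, intended for 1 <= k <= n. The multiplicity k_j
   (1 <= j <= n - k + 1) is stored at the ordinal j - 1. Bounding the values
   by n loses nothing, because \sum_j j k_j = n forces k_j <= n. *)
Definition bell_index (n k : nat) : {set {ffun 'I_(n - k).+1 -> 'I_n.+1}} :=
  [set m : {ffun 'I_(n - k).+1 -> 'I_n.+1} |
     (\sum_(i < (n - k).+1) m i == k)%N &&
     (\sum_(i < (n - k).+1) i.+1 * m i == n)%N].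

(* The value B_{n,k}(x_1, ..., x_{n-k+1}); x j stands for x_j, and only
   x 1, ..., x (n - k + 1) are used. *)
Definition bell (F : fieldType) (n k : nat) (x : nat -> F) : F :=
  n`!%:R * \sum_(m in bell_index n k)
    \prod_(i < (n - k).+1)
      ((m i)`!%:R^-1 * (x i.+1 / (i.+1)`!%:R) ^+ m i).

(* Main.v *)
Require Import Defs.
From HB Require Import structures.
From mathcomp Require Import all_boot all_order all_algebra.
From mathcomp Require Import reals.
From mathcomp Require Import ring.
Local Open Scope ring_scope.

(** Put u(t) = (1+t)^alpha - 1.  Since B_{n,k}((alpha)_1, (alpha)_2, ...) is
    n!/k! times the coefficient of t^n in u^k, the left-hand side is n! times
    the coefficient of t^n in (1+u)^c = (1+t)^(alpha c) for c = 1 - 1/alpha,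
    where alpha c = alpha - 1.  The identity (1+u)^c = (1+t)^(alpha c) holds
    for natural c by Vandermonde's convolution, and extends to all c because
    both sides have coefficients polynomial in c. *)

Import GRing.Theory Num.Theory.

Lemma fact_natr_neq0 {F : numFieldType} (n : nat) : n`!%:R != 0 :> F.
Proof. by rewrite pnatr_eq0 -lt0n fact_gt0. Qed.

Lemma bin_natr_fact {F : numFieldType} (n k : nat) : (k <= n)%N ->
  'C(n, k)%:R = n`!%:R * k`!%:R^-1 * (n - k)`!%:R^-1 :> F.
Proof.
move=> kn; rewrite -(bin_fact kn) !natrM.
have h1 := @fact_natr_neq0 F k; have h2 := @fact_natr_neq0 F (n - k).
by field; rewrite h1 h2.
Qed.

(** A nonzero polynomial has fewer roots than its size, whereas in characteristic zero the first
    [size p] naturals would be that many distinct roots. *)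
Lemma poly_eq0_on_nat {F : numFieldType} (p : {poly F}) :
  (forall m : nat, p.[m%:R] = 0) -> p = 0.
Proof.
move=> p0; apply/eqP; apply: contraT => pn0.
have := @max_poly_roots _ p [seq m%:R | m <- iota 0 (size p)] pn0.
rewrite size_map size_iota ltnn; apply.
  by apply/allP => _ /mapP[m _ ->]; rewrite /root p0.
rewrite map_inj_uniq ?iota_uniq // => i j /eqP.
by rewrite eqr_nat => /eqP.
Qed.

Lemma coefX_eq_le {R : nzRingType} (p q : {poly R}) (d k : nat) :
  (forall i, (i <= d)%N -> p`_i = q`_i) ->
  forall i, (i <= d)%N -> (p ^+ k)`_i = (q ^+ k)`_i.
Proof.
move=> pq; elim: k => [|k IH] i id; first by rewrite !expr0.
rewrite !exprS !coefM; apply: eq_bigr => j _.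
rewrite pq ?IH //; first exact: leq_trans (leq_subr _ _) id.
by apply: leq_trans id; rewrite -ltnS.
Qed.

(** The series exp(zX) cut after degree [n]. Coefficients lie in an algebra so that [z] may itself
    be a polynomial. *)
Definition trunc_expp {F : fieldType} {A : comAlgType F} (n : nat) (z : A) :
  {poly A} := \poly_(a < n.+1) (a`!%:R^-1 *: z ^+ a).

(** A product of exponentials is the exponential of the sum, one factor at a time by the binomial
    theorem; the cut does not affect degrees up to [n]. *)
Lemma coef_prod_trunc_expp {F : numFieldType} {A : comAlgType F}
    (I : Type) (s : seq I) (n k : nat) (z : I -> A) : (k <= n)%N ->
  (\prod_(i <- s) trunc_expp n (z i))`_k =
  k`!%:R^-1 *: (\sum_(i <- s) z i) ^+ k.
Proof.
elim: s k => [|i s IH] k kn.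
  rewrite !big_nil coef1 expr0n; case: k {kn} => [|k] /=.
    by rewrite invr1 scale1r.
  by rewrite scaler0.
rewrite !big_cons coefMr exprDn scaler_sumr.
apply: eq_bigr => j _; have jk : (j <= k)%N by rewrite -ltnS.
rewrite IH ?(leq_trans jk) // coef_poly ltnS (leq_trans (leq_subr _ _) kn).
rewrite -scalerAl -scalerAr scalerA -[_ *+ 'C(_, _)]scaler_nat scalerA.
congr (_ *: _); rewrite bin_natr_fact //.
have h := @fact_natr_neq0 F k; have h1 := @fact_natr_neq0 F j.
by have h2 := @fact_natr_neq0 F (k - j); field; rewrite h h1 h2.
Qed.

(** Distributing the product of exponentials picks the term of degree [m i] in each factor, and the
    power of ['X] records the sum of these degrees. The cut at [n] matches the range ['I_n.+1]. *)
Lemma multinomial_ffun {F : numFieldType} {A : comAlgType F}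
    (r n k : nat) (z : 'I_r -> A) : (k <= n)%N ->
  \sum_(m : {ffun 'I_r -> 'I_n.+1} | (\sum_i m i == k)%N)
     \prod_i ((m i)`!%:R^-1 *: z i ^+ m i)
  = k`!%:R^-1 *: (\sum_i z i) ^+ k.
Proof.
move=> kn; rewrite -(@coef_prod_trunc_expp F A _ _ n) //.
under [in RHS]eq_bigr do rewrite /trunc_expp poly_def.
rewrite bigA_distr_bigA /= coef_sum big_mkcond /=; apply: eq_bigr => m _.
under [in RHS]eq_bigr do rewrite -mul_polyC.
rewrite big_split /= -rmorph_prod /= coefCM.
rewrite -expr_sum.
by rewrite coefXn eq_sym; case: ifP; rewrite ?mulr1 ?mulr0.
Qed.

(** The multinomial theorem over [{poly F}] absorbs the constraint on the sum of the [m i]; the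
    variable of [{poly F}] tracks the weighted sum, which must equal [n]. *)
Lemma bell_coef {F : numFieldType} (n k : nat) (x : nat -> F) : (k <= n)%N ->
  bell n k x = n`!%:R / k`!%:R *
    ((\sum_(i < (n - k).+1) (x i.+1 / (i.+1)`!%:R) *: 'X^(i.+1)) ^+ k)`_n.
Proof.
move=> kn; rewrite /bell -mulrA; congr (_ * _).
rewrite -coefZ -(@multinomial_ffun F {poly F} _ n) // coef_sum.
rewrite big_mkcond [RHS]big_mkcond; apply: eq_bigr => m _.
rewrite inE; case: eqP => //= _.
under [in RHS]eq_bigr do rewrite exprZn scalerA -mul_polyC -exprM.
rewrite [in RHS]big_split /= -rmorph_prod /= coefCM.
rewrite -expr_sum.
by rewrite coefXn eq_sym; case: eqP; rewrite ?mulr1 ?mulr0.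
Qed.

Lemma ffactr0 {R : pzRingType} (x : R) : ffactr x 0 = 1.
Proof. exact: big_ord0. Qed.

Lemma ffactrS {R : pzRingType} (x : R) (k : nat) :
  ffactr x k.+1 = ffactr x k * (x - k%:R).
Proof. exact: big_ord_recr. Qed.

Lemma ffactr_nat {R : pzRingType} (m k : nat) :
  ffactr (m%:R : R) k = (m ^_ k)%:R.
Proof.
elim: k => [|k IH]; first by rewrite ffactr0 ffactn0.
rewrite ffactrS IH ffactnSr natrM; case: (leqP k m) => [km|mk].
  by rewrite natrB.
by rewrite ffact_small // !mul0r.
Qed.

Lemma horner_ffactr {R : comNzRingType} (p : {poly R}) (k : nat) (c : R) :
  (ffactr p k).[c] = ffactr p.[c] k.
Proof.
rewrite /ffactr horner_prod; apply: eq_bigr => i _.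
by rewrite hornerD hornerN -polyC_natr hornerC.
Qed.

Definition gbin {F : fieldType} (x : F) (k : nat) : F := ffactr x k / k`!%:R.

Lemma gbin0 {F : fieldType} (x : F) : gbin x 0 = 1.
Proof. by rewrite /gbin ffactr0 invr1 mulr1. Qed.

Lemma gbinS {F : numFieldType} (x : F) (k : nat) :
  k.+1%:R * gbin x k.+1 = (x - k%:R) * gbin x k.
Proof.
rewrite /gbin ffactrS factS natrM.
have h := @fact_natr_neq0 F k.
have h1 : k.+1%:R != 0 :> F by rewrite pnatr_eq0.
have {h1}h1 : 1 + k%:R != 0 :> F by rewrite -natr1 addrC in h1.
by field; rewrite h h1.
Qed.

Lemma gbin_Vandermonde {F : numFieldType} (a b : F) (n : nat) :
  \sum_(i < n.+1) gbin a i * gbin b (n - i) = gbin (a + b) n.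
Proof.
elim: n => [|n IH]; first by rewrite big_ord1 !gbin0 mulr1.
have n0 : n.+1%:R != 0 :> F by rewrite pnatr_eq0.
apply: (mulfI n0); rewrite gbinS -IH !mulr_sumr.
(* Split the factor n+1 as i + (n+1-i), and a + b - n as (a-i) + (b-(n-i)). *)
transitivity (\sum_(i < n.+2) (i%:R * gbin a i * gbin b (n.+1 - i))
   + \sum_(i < n.+2) (gbin a i * ((n.+1 - i)%:R * gbin b (n.+1 - i)))).
  rewrite -big_split; apply: eq_bigr => i _ /=.
  rewrite -[in n.+1%:R](@subnKC i n.+1) -1?ltnS // natrD; ring.
(* The first sum loses its term at 0 and the second its term at n+1, so both range over n+1
   indices. *)
rewrite big_ord_recl !mul0r add0r.
rewrite [X in _ + X]big_ord_recr /= subnn mul0r mulr0 addr0.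
rewrite -big_split; apply: eq_bigr => i _ /=.
have iln : (i <= n)%N by rewrite -ltnS.
rewrite /bump /= add1n subSS gbinS subSn // gbinS natrB //; ring.
Qed.

Definition binp {F : fieldType} (n : nat) (a : F) : {poly F} :=
  \poly_(i < n.+1) gbin a i.

(** [binp n a] is (1+X)^a cut after degree [n]; by Vandermonde each further factor adds [a] to the
    exponent. *)
Lemma coef_binpX {F : numFieldType} (n m i : nat) (a : F) : (i <= n)%N ->
  (binp n a ^+ m)`_i = gbin (m%:R * a) i.
Proof.
elim: m i => [|m IH] i iln.
  rewrite expr0 coef1 mul0r; case: i iln => [|i] _; first by rewrite gbin0.
  by rewrite /gbin -[X in ffactr X]/(0%:R) ffactr_nat ffact0n mul0r.
rewrite exprS coefM -natr1 mulrDl mul1r addrC -gbin_Vandermonde.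
apply: eq_bigr => j _; have ji : (j <= i)%N by rewrite -ltnS.
by rewrite coef_poly ltnS (leq_trans ji) // IH // (leq_trans (leq_subr _ _)).
Qed.

(** A truncation of ((1+X)^a - 1)/X: with ['X] split off, it is visible that ['X^k] divides the k-th
    power of u. *)
Definition binq {F : fieldType} (n : nat) (a : F) : {poly F} :=
  \poly_(i < n) gbin a i.+1.

Lemma binpE {F : fieldType} (n : nat) (a : F) :
  binp n a = 1 + binq n a * 'X.
Proof.
apply/polyP => -[|i]; rewrite coefD coef1 coefMX !coef_poly /= ?add0r //.
by rewrite gbin0 addr0.
Qed.

Lemma bell_binq {F : numFieldType} (n k : nat) (a : F) :
  (0 < k)%N -> (k <= n)%N ->
  bell n k (ffactr a) = n`!%:R / k`!%:R * ((binq n a * 'X) ^+ k)`_n.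
Proof.
move=> k0 kn; rewrite bell_coef //; congr (_ * _).
have -> : \sum_(i < (n - k).+1) (ffactr a i.+1 / (i.+1)`!%:R) *: 'X^(i.+1)
          = binq (n - k).+1 a * 'X.
  rewrite /binq poly_def mulr_suml; apply: eq_bigr => i _.
  by rewrite -scalerAl -exprSr.
(* After cancelling ['X^k] only degrees up to n-k matter, and there both truncations agree because k
   > 0. *)
rewrite !exprMn !coefMXn ltnNge kn /=; apply: coefX_eq_le (leqnn _) => i ik.
by rewrite !coef_poly ltnS ik (leq_ltn_trans ik) // ltn_subrL k0 (leq_trans k0).
Qed.

Lemma gbin_comp_nat {F : numFieldType} (n m : nat) (a : F) :
  \sum_(k < n.+1) gbin m%:R k * ((binq n a * 'X) ^+ k)`_n = gbin (m%:R * a) n.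
Proof.
rewrite -(@coef_binpX F n) // binpE addrC exprD1n coef_sum.
pose f k := gbin (m%:R : F) k * ((binq n a * 'X) ^+ k)`_n.
have fE k : ((binq n a * 'X) ^+ k *+ 'C(m, k))`_n = f k.
  rewrite coefMn /f /gbin ffactr_nat -bin_ffact natrM mulfK ?fact_natr_neq0 //.
  by rewrite mulr_natl.
under [RHS]eq_bigr do rewrite fE.
(* The binomial theorem sums up to m, the statement up to n. Both extend to a common bound: ['X^k]
   kills the terms with k > n, and [m ^_ k] those with k > m. *)
have ext d : (n <= d)%N -> (m <= d)%N ->
    \sum_(k < n.+1) f k = \sum_(k < d.+1) f k
    /\ \sum_(k < m.+1) f k = \sum_(k < d.+1) f k.
  move=> nd md; split.
    rewrite (big_ord_widen d.+1 f) // big_mkcond /=; apply: eq_bigr => k _.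
    case: ltnP => // nk.
    by rewrite /f exprMn coefMXn nk mulr0.
  rewrite (big_ord_widen d.+1 f) // big_mkcond /=; apply: eq_bigr => k _.
  case: ltnP => // mk.
  by rewrite /f /gbin ffactr_nat ffact_small // !mul0r.
have [-> ->] // := ext (maxn n m) (leq_maxl _ _) (leq_maxr _ _).
Qed.

Lemma gbin_comp {F : numFieldType} (n : nat) (a c : F) :
  \sum_(k < n.+1) gbin c k * ((binq n a * 'X) ^+ k)`_n = gbin (c * a) n.
Proof.
(* The difference of the two sides as a polynomial in [c], with falling factorials taken in
   [{poly F}]. *)
pose P : {poly F} :=
  \sum_(k < n.+1)
     (((binq n a * 'X) ^+ k)`_n / k`!%:R) *: ffactr ('X : {poly F}) k
  - n`!%:R^-1 *: ffactr (a *: 'X : {poly F}) n.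
have PE x : P.[x] =
    \sum_(k < n.+1) gbin x k * ((binq n a * 'X) ^+ k)`_n - gbin (x * a) n.
  rewrite hornerD hornerN horner_sum hornerZ horner_ffactr hornerZ hornerX.
  congr (_ - _); last by rewrite /gbin [x * a]mulrC [RHS]mulrC.
  apply: eq_bigr => k _; rewrite hornerZ horner_ffactr hornerX /gbin.
  by rewrite mulrC mulrA mulrAC.
have P0 : P = 0.
  by apply: poly_eq0_on_nat => m; rewrite PE gbin_comp_nat subrr.
by apply/eqP; rewrite -subr_eq0 -PE P0 horner0.
Qed.

Theorem theorem3p2 (R : realType) (alpha : R) (n : nat)
    (halpha : alpha != 0) (hn : (0 < n)%N) :
  \sum_(1 <= k < n.+1)
      ffactr (1 - 1 / alpha) k * bell n k (fun j => ffactr alpha j)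
  = ffactr (alpha - 1) n.
Proof.
have := @gbin_comp R n alpha (1 - 1 / alpha).
have -> : (1 - 1 / alpha) * alpha = alpha - 1 by field.
(* The term k = 0 is a multiple of the coefficient of ['X^n] in 1, which is zero since n > 0. *)
rewrite big_ord_recl expr0 coef1 eqn0Ngt hn mulr0 add0r.
move=> /(congr1 (fun y => n`!%:R * y)).
rewrite [RHS]mulrC divfK ?fact_natr_neq0 // => <-.
rewrite big_add1 big_mkord mulr_sumr; apply: eq_bigr => k _.
rewrite (@bell_binq R n k.+1) // /gbin lift0; ring.
Qed.
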